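(* Let $k\geq 2$ be an integer. Then every Class 1 graph with maximum degree at most $k$ has the Vizing property if and only if for every graph $G$ with $\Delta(G)\leq k$ all proper $(\chi'(G)+1)$-edge colorings of $G$ are Kempe equivalent.
   Context: All graphs are finite, without loops and multiple edges. $\Delta(G)$ is the maximum degree of $G$. A proper $t$-edge coloring of $G$ is a map $f:E(G)\to\{1,\dots,t\}$ with $f(e)\neq f(e')$ for adjacent edges $e,e'$. The chromatic index $\chi'(G)$ is the least $k$ for which a proper $k$-edge coloring exists; $G$ is Class 1 if $\chi'(G)=\Delta(G)$. For a proper edge coloring $f$ and colors $a,b$, $G_f(a,b)$ is the subgraph induced by the edges colored $a$ or $b$. An interchange (Kempe change) consists of swapping colors $a$ and $b$ on one connected component of $G_f(a,b)$. Two proper edge colorings are Kempe equivalent if one can be obtained from the other by a sequence of interchanges. A Class 1 graph $G$ has the Vizing property if for every $t\geq\Delta(G)+1$, every proper $t$-edge coloring of $G$ can be transformed by a sequence of interchanges into a proper $\Delta(G)$-edge coloring of $G$ (i.e. one using only colors from $\{1,\dots,\Delta(G)\}$). *)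

(* Defs.v *)
(* Simple graphs: a symmetric irreflexive relation e on a finType T. *)
From mathcomp Require Import all_boot.
From Stdlib Require Import Relations.
Set Implicit Arguments. Unset Strict Implicit. Unset Printing Implicit Defensive.

Section Graphs.
Variables (T : finType) (e : rel T).

Definition is_edge (A : {set T}) : bool :=
  [exists x, exists y, e x y && (A == [set x; y])].

Definition adj_edges (A B : {set T}) : bool :=
  [&& is_edge A, is_edge B, A != B & A :&: B != set0].

Definition degree (x : T) : nat := #|[set y | e x y]|.

Definition maxdeg : nat := \max_(x : T) degree x.

(* Edge colorings are maps from vertex sets to colors (only values on edges matter). *)
Definition coloring := {set T} -> nat.

Definition proper_coloring (t : nat) (f : coloring) : Prop :=
  (forall A, is_edge A -> 1 <= f A <= t) /\
  (forall A B, adj_edges A B -> f A != f B).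

Definition colorable (t : nat) : Prop := exists f, proper_coloring t f.

Definition chromatic_index (c : nat) : Prop :=
  colorable c /\ forall j, colorable j -> c <= j.

Definition class1 : Prop := chromatic_index maxdeg.

Definition ab_rel (f : coloring) (a b : nat) : rel {set T} :=
  fun A B => [&& adj_edges A B, f A \in [:: a; b] & f B \in [:: a; b]].

Definition swap_col (a b c : nat) : nat :=
  if c == a then b else if c == b then a else c.

Definition kempe_step (t : nat) (f g : coloring) : Prop :=
  exists a b A0,
    [/\ 1 <= a <= t, 1 <= b <= t, is_edge A0, f A0 \in [:: a; b] &
     forall A, is_edge A ->
       g A = if connect (ab_rel f a b) A0 A then swap_col a b (f A) else f A].

Definition agree_on_edges (f g : coloring) : Prop :=
  forall A, is_edge A -> f A = g A.

(* Kempe equivalence (colorings identified when they agree on all edges). *)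
Definition kempe_equiv (t : nat) : relation coloring :=
  clos_refl_trans coloring (fun f g => kempe_step t f g \/ agree_on_edges f g).

Definition vizing_property : Prop :=
  forall t, maxdeg < t -> forall f, proper_coloring t f ->
    exists g, kempe_equiv t f g /\ proper_coloring maxdeg g.

End Graphs.

(* Main.v *)
(* Recolouring an edge with a colour absent from its neighbours is an
   interchange.  Hence Vizing's fan argument, applied to an edge coloured t+1,
   shows that for t > Delta every (t+1)-colouring is Kempe equivalent to a
   t-colouring.  From right to left, this lowers the number of colours to
   Delta + 1, where the hypothesis applies.  From left to right, induct on the
   chromatic index c: reduce both (c+1)-colourings to c-colourings f and g (by
   the Vizing property if c = Delta, by Vizing's argument if c > Delta), and
   give the new colour c+1 to the edges of M = g^-1(c), in f as well as in g.
   What remains is to relate two c-colourings of G - M, a graph of chromatic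
   index c - 1. *)
From Stdlib Require Import Relation_Operators.
From mathcomp Require Import all_boot.
Require Import Defs.
Set Implicit Arguments. Unset Strict Implicit. Unset Printing Implicit Defensive.

(** * Transposing two colours *)

Section SwapCol.
Variables a b : nat.

Lemma swap_col_id c : c \notin [:: a; b] -> swap_col a b c = c.
Proof. by rewrite !inE negb_or /swap_col => /andP[/negPf-> /negPf->]. Qed.

Lemma swap_colK : involutive (swap_col a b).
Proof.
move=> c; rewrite /swap_col.
have [->|ca] := eqVneq c a; first by have [->|_] := eqVneq b a; rewrite ?eqxx.
have [->|cb] := eqVneq c b; first by rewrite eqxx.
by rewrite (negPf ca) (negPf cb).
Qed.

Lemma swap_col_in c : (swap_col a b c \in [:: a; b]) = (c \in [:: a; b]).
Proof.
have [|cN] := boolP (c \in [:: a; b]); last by rewrite swap_col_id // (negPf cN).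
rewrite !inE /swap_col; have [_|_] := eqVneq c a; first by rewrite eqxx orbT.
by move=> /= ->; rewrite eqxx.
Qed.

Lemma swap_col_eq c d : d \notin [:: a; b] -> (swap_col a b c == d) = (c == d).
Proof.
by move=> dN; rewrite -(inj_eq (inv_inj swap_colK)) swap_colK (swap_col_id dN).
Qed.

Lemma swap_col_range t c :
  1 <= a <= t -> 1 <= b <= t -> 1 <= c <= t -> 1 <= swap_col a b c <= t.
Proof. by rewrite /swap_col; case: ifP => // _; case: ifP. Qed.

End SwapCol.

(* In the orbit of a fixed point of [s] under the dihedral group generated by
   two involutions, [s'] has at most one fixed point: writing [r] for the
   rotation, [r^i u] is fixed by [s'] iff [r^(2i) u = r u]. *)
Section Dihedral.
Variables (T : finType) (s s' : T -> T).
Hypotheses (sK : involutive s) (sK' : involutive s').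
Variable u : T.
Hypothesis su : s u = u.

Let r x := s' (s x).

Lemma rotation_inj : injective r.
Proof. exact: inj_comp (inv_inj sK') (inv_inj sK). Qed.

(** As [r (s (r x)) = s x], conjugation by [s] inverts the rotation. *)
Lemma iter_rotation_refl i x : iter i r (s (iter i r x)) = s x.
Proof. by elim: i x => //= i IH x; rewrite -iterS iterSr /r sK sK' IH. Qed.

(** Since [s u = u], [s] takes [r^i u] to [r^(-i) u], which lies on the same finite cycle. *)
Lemma orbit_s x : fconnect r u x -> fconnect r u (s x).
Proof.
move/iter_findex => <-; set i := findex _ _ _.
rewrite fconnect_sym; last exact: rotation_inj.
by rewrite -[X in fconnect _ _ X]su -(iter_rotation_refl i u) fconnect_iter.
Qed.

Lemma orbit_s' x : fconnect r u x -> fconnect r u (s' x).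
Proof.
by move=> /orbit_s ux; apply: connect_trans ux _; rewrite -{2}[x]sK fconnect1.
Qed.

Lemma orbit_fixed_unique x y :
  fconnect r u x -> fconnect r u y -> s' x = x -> s' y = y -> x = y.
Proof.
have fixE z : s' z = z -> fconnect r u z ->
    exists2 i, z = iter i r u & forall m, iter (m * i.*2) r u = iter m r u.
  move=> s'z uz; have := iter_findex uz; set i := findex _ _ _ => zE.
  exists i => //.
  (* Here [z = r (s z)], so [r^(2i) u = r^i z = r (r^i (s (r^i u))) = r (s u)]. *)
  have r2i : iter i.*2 r u = r u.
    rewrite -addnn iterD zE -{1}s'z -[z in s' z]sK -/(r (s z)).
    by rewrite -iterSr iterS -zE iter_rotation_refl su.
  elim=> // m IHm; rewrite mulSn iterD IHm -iterD addnC iterD r2i.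
  by rewrite -iterSr.
move=> ux uy /fixE-/(_ ux)[i -> iE] /fixE-/(_ uy)[j -> jE].
by rewrite -jE -[RHS]iE -!muln2 !mulnA [j * i]mulnC.
Qed.

End Dihedral.

(** * Paths in a relation *)

Section Paths.
Variables (T : eqType) (r r' : rel T) (P : pred T).

Lemma sub_belast_path x p : (forall y z, P y -> r y z -> r' y z) ->
  all P (belast x p) -> path r x p -> path r' x p.
Proof.
move=> rr'; elim: p x => //= y p IHp x /andP[Px Pp] /andP[rxy rp].
by rewrite (rr' _ _ Px rxy) IHp.
Qed.

(** [q] is the prefix of [p] up to the first vertex in [P]; its inclusion in [p] carries uniqueness
    through the induction. *)
Lemma first_on_path x p : path r x p -> uniq (x :: p) -> P (last x p) ->
  exists q, [/\ path r x q, uniq (x :: q), P (last x q),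
                all (predC P) (belast x q) & {subset q <= p}].
Proof.
elim: p x => [|y p IHp] x; first by exists [::].
have [Px _ _ _|Px] := boolP (P x); first by exists [::].
move=> /= /andP[rxy rp] /andP[xp up] Pl.
have [q [rq uq Pq Nq qp]] := IHp y rp up Pl.
exists (y :: q); split; rewrite //= ?rxy ?Px //.
  rewrite -/(uniq (y :: q)) uq andbT; apply: contra xp.
  by rewrite !inE => /orP[->//|/qp->]; rewrite orbT.
by move=> z; rewrite !inE => /orP[->//|/qp->]; rewrite orbT.
Qed.

End Paths.

(** * Edges, proper colourings and Kempe equivalence *)

Section Coloring.
Variables (T : finType) (e : rel T).
Hypotheses (sym : symmetric e) (irr : irreflexive e).
Implicit Types (u v x y z : T) (A B : {set T}) (f g : coloring T).

Lemma is_edgeP A : reflect (exists x y, e x y /\ A = [set x; y]) (is_edge e A).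
Proof.
apply: (iffP existsP) => [[x /existsP[y /andP[exy /eqP->]]]|[x [y [exy ->]]]].
  by exists x, y.
by exists x; apply/existsP; exists y; rewrite exy eqxx.
Qed.

Lemma is_edge_at A v : is_edge e A -> v \in A -> exists2 z, e v z & A = [set v; z].
Proof.
move=> /is_edgeP[x [y [exy ->]]]; rewrite !inE => /orP[] /eqP->.
  by exists y.
by exists x; rewrite 1?sym // setUC.
Qed.

Lemma is_edge_pair x y : e x y -> is_edge e [set x; y].
Proof. by move=> exy; apply/is_edgeP; exists x, y. Qed.

Lemma adj_edges_sym A B : adj_edges e A B = adj_edges e B A.
Proof. by rewrite /adj_edges andbCA eq_sym setIC. Qed.

Lemma adj_edges_common A B v :
  is_edge e A -> is_edge e B -> A != B -> v \in A -> v \in B -> adj_edges e A B.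
Proof.
move=> eA eB AB vA vB; apply/and4P; split=> //.
by apply/set0Pn; exists v; rewrite inE vA.
Qed.

Lemma adj_edgesP A B : adj_edges e A B ->
  [/\ is_edge e A, is_edge e B, A != B & exists2 v, v \in A & v \in B].
Proof.
case/and4P=> eA eB AB /set0Pn[v]; rewrite inE => /andP[vA vB].
by split=> //; exists v.
Qed.

Lemma set2_injr v y z : e v y -> [set v; y] = [set v; z] -> y = z.
Proof.
move=> evy /setP/(_ y); rewrite !inE eqxx orbT => /esym/orP[] /eqP // yv.
by rewrite yv irr in evy.
Qed.

Lemma proper_edge_inj t f A B v : proper_coloring e t f ->
  is_edge e A -> is_edge e B -> v \in A -> v \in B -> f A = f B -> A = B.
Proof.
move=> [_ fP] eA eB vA vB fAB; apply/eqP; apply: contraT => AB.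
by have := fP _ _ (adj_edges_common eA eB AB vA vB); rewrite fAB eqxx.
Qed.

Lemma proper_pair_inj t f v y z : proper_coloring e t f ->
  e v y -> e v z -> f [set v; y] = f [set v; z] -> y = z.
Proof.
move=> fP evy evz fE; apply: (set2_injr evy).
apply: (proper_edge_inj fP (is_edge_pair evy) (is_edge_pair evz)) fE; exact: set21.
Qed.

Lemma agree_proper t f g :
  agree_on_edges e f g -> proper_coloring e t f -> proper_coloring e t g.
Proof.
move=> fg [f1 f2]; split=> [A eA|A B AB]; first by rewrite -fg // f1.
by have [eA eB _ _] := adj_edgesP AB; rewrite -!fg // f2.
Qed.

Lemma proper_widen t t' f :
  t <= t' -> proper_coloring e t f -> proper_coloring e t' f.
Proof.
move=> tt' [f1 f2]; split=> // A /f1/andP[-> fA]; exact: leq_trans fA tt'.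
Qed.

Lemma connect_ab_rel_in f a b A B : f A \in [:: a; b] ->
  connect (ab_rel e f a b) A B -> f B \in [:: a; b].
Proof.
move=> fA /connectP[p]; elim/last_ind: p => [_ -> //|p C _].
by rewrite rcons_path last_rcons => /andP[_ /and3P[_ _ ?]] ->.
Qed.

Lemma kempe_step_proper t f g :
  kempe_step e t f g -> proper_coloring e t f -> proper_coloring e t g.
Proof.
move=> [a [b [A0 [at_ bt eA0 fA0 gE]]]] [f1 f2].
(* An edge adjacent to the component but off it has neither colour [a] nor [b], so the swap fixes
   its colour and creates no conflict. *)
have mixed A B : adj_edges e A B -> connect (ab_rel e f a b) A0 A ->
    ~~ connect (ab_rel e f a b) A0 B -> g A != g B.
  move=> AB cA cB; have [eA eB _ _] := adj_edgesP AB.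
  rewrite !gE // cA (negPf cB); have fA := connect_ab_rel_in fA0 cA.
  rewrite swap_col_eq; first exact: f2.
  apply: contra cB => fB; apply: connect_trans cA _; apply: connect1.
  exact/and3P.
split=> [A eA|A B AB].
  by rewrite gE //; case: ifP => _; [apply: swap_col_range|]; rewrite ?f1.
have [eA eB _ _] := adj_edgesP AB.
have [cA|cA] := boolP (connect (ab_rel e f a b) A0 A);
have [cB|cB] := boolP (connect (ab_rel e f a b) A0 B).
- by rewrite !gE // cA cB (inj_eq (inv_inj (@swap_colK a b))) f2.
- exact: mixed.
- by rewrite eq_sym mixed // adj_edges_sym.
- by rewrite !gE // (negPf cA) (negPf cB) f2.
Qed.

(** An interchange leaves the two-coloured components unchanged, so repeating it undoes it. *)
Lemma kempe_step_sym t f g : kempe_step e t f g -> kempe_step e t g f.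
Proof.
move=> [a [b [A0 [at_ bt eA0 fA0 gE]]]].
have gin A : is_edge e A -> (g A \in [:: a; b]) = (f A \in [:: a; b]).
  by move=> eA; rewrite gE //; case: ifP => _ //; rewrite swap_col_in.
have relE : ab_rel e g a b =2 ab_rel e f a b.
  move=> A B; rewrite /ab_rel; have [/adj_edgesP[eA eB _ _]|//] := boolP (adj_edges e A B).
  by rewrite !gin.
exists a, b, A0; split; rewrite ?gin // => A eA.
by rewrite (eq_connect relE) gE //; case: (connect _ A0 A); rewrite ?swap_colK.
Qed.

Lemma kempe_equiv_sym t f g : kempe_equiv e t f g -> kempe_equiv e t g f.
Proof.
elim=> [{}f {}g fg|{}f|{}f {}g h _ gf _ hg]; last exact: rt_trans hg gf.
  by apply: rt_step; case: fg => [/kempe_step_sym|fg]; [left|right=> A /fg].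
exact: rt_refl.
Qed.

Lemma kempe_equiv_proper t f g :
  kempe_equiv e t f g -> proper_coloring e t f -> proper_coloring e t g.
Proof.
elim=> [{}f {}g [|]|//|{}f {}g h _ fg _ gh /fg//].
  exact: kempe_step_proper.
exact: agree_proper.
Qed.

Lemma kempe_equiv_widen t t' f g :
  t <= t' -> kempe_equiv e t f g -> kempe_equiv e t' f g.
Proof.
move=> tt'; elim=> [{}f {}g fg|{}f|{}f {}g h _ gf _ hg]; last exact: rt_trans gf hg.
  apply: rt_step; case: fg => [[a [b [A0 [/andP[a1 a2] /andP[b1 b2] eA0 fA0 gE]]]]|];
    [left|by right].
  by exists a, b, A0; split; rewrite ?a1 ?b1 //= (leq_trans _ tt').
exact: rt_refl.
Qed.

Lemma agree_kempe_equiv t f g : agree_on_edges e f g -> kempe_equiv e t f g.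
Proof. by move=> fg; apply: rt_step; right. Qed.

(** * Recolouring edges and matchings *)

Definition recolor f A c : coloring T := fun B => if B == A then c else f B.

(** No edge adjacent to [A] has colour [f A], by properness, or [c]; so [A] alone is a component for
    these two colours. *)
Lemma recolor_kempe t f A c : proper_coloring e t f -> is_edge e A ->
  1 <= c <= t -> (forall B, adj_edges e A B -> f B != c) ->
  kempe_equiv e t f (recolor f A c).
Proof.
move=> [f1 f2] eA ct cN; apply: rt_step; left.
exists (f A), c, A; split; rewrite ?f1 ?inE ?eqxx // => B eB; rewrite /recolor.
have [->|BA] := eqVneq B A; first by rewrite connect0 /swap_col eqxx.
rewrite ifN //; apply: contra BA => /connectP[[|C p] /=]; first by move=> _ ->.
case/andP=> /and3P[AC _]; rewrite !inE => /orP[] /eqP fC.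
  by have := f2 _ _ AC; rewrite fC eqxx.
by have := cN _ AC; rewrite fC eqxx.
Qed.

(** The edges are recoloured one at a time: [c] then occurs only on edges of [s] already treated,
    none of them adjacent to the next. *)
Lemma recolor_matching_kempe t f (s : seq {set T}) c : proper_coloring e t f ->
  {in s, forall A, is_edge e A} -> {in s &, forall A B, ~~ adj_edges e A B} ->
  1 <= c <= t -> (forall A, is_edge e A -> f A != c) ->
  kempe_equiv e t f (fun A => if A \in s then c else f A).
Proof.
move=> fP; elim: s => [|A s IHs] sE sM ct cN; first exact: agree_kempe_equiv.
have fh : kempe_equiv e t f (fun A => if A \in s then c else f A).
  apply: IHs => // [B Bs|B C Bs Cs]; first by apply: sE; rewrite inE Bs orbT.
  by apply: sM; rewrite inE ?Bs ?Cs orbT.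
have hP := kempe_equiv_proper fh fP.
apply: rt_trans fh _.
have [As|As] := boolP (A \in s).
  apply: agree_kempe_equiv => B _; rewrite inE.
  by have [->|] := eqVneq B A; rewrite ?As.
have eA : is_edge e A by apply: sE; rewrite mem_head.
apply: rt_trans (recolor_kempe hP eA ct _) _ => [B AB|].
  have [_ eB _ _] := adj_edgesP AB.
  case: ifP => Bs; last exact: cN.
  by have := sM A B; rewrite !inE eqxx Bs orbT AB => /(_ isT isT).
apply: agree_kempe_equiv => B _; rewrite /recolor inE.
by case: (B == A).
Qed.

(** * Missing colours and alternating chains *)

Definition misses f v c := [forall y, e v y ==> (f [set v; y] != c)].

Lemma missesP f v c :
  reflect (forall A, is_edge e A -> v \in A -> f A != c) (misses f v c).
Proof.
apply: (iffP forallP) => [h A eA vA|h y]; last first.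
  by apply/implyP => evy; apply: h; rewrite ?is_edge_pair ?set21.
by have [z evz ->] := is_edge_at eA vA; apply: (implyP (h z)).
Qed.

Lemma missesPn f v c :
  reflect (exists2 y, e v y & f [set v; y] = c) (~~ misses f v c).
Proof.
rewrite negb_forall; apply: (iffP existsP) => [[y]|[y evy fE]].
  by rewrite negb_imply negbK => /andP[evy /eqP]; exists y.
by exists y; rewrite negb_imply evy fE eqxx.
Qed.

Lemma ex_misses f v t : degree e v < t -> exists2 c, 1 <= c <= t & misses f v c.
Proof.
move=> dt; set s := [seq f [set v; y] | y <- enum [set y | e v y]].
have [/allP sub|/allPn[c]] := boolP (all [in s] (iota 1 t)).
  have := uniq_leq_size (iota_uniq 1 t) sub.
  by rewrite size_iota size_map -cardE leqNgt dt.
rewrite mem_iota add1n ltnS => ct cs; exists c => //.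
apply: contraR cs => /missesPn[y evy <-].
by apply: (map_f (fun y => f [set v; y])); rewrite mem_enum inE.
Qed.

Lemma proper_maxdeg t f : proper_coloring e t f -> maxdeg e <= t.
Proof.
move=> fP; apply/bigmax_leqP => v _.
pose s := [seq f [set v; y] | y <- enum [set y | e v y]].
have us : uniq s.
  rewrite map_inj_in_uniq ?enum_uniq // => y z; rewrite !mem_enum !inE.
  exact: proper_pair_inj fP.
have ss : {subset s <= iota 1 t}.
  move=> c /mapP[y]; rewrite mem_enum inE => evy ->.
  by rewrite mem_iota add1n ltnS (proj1 fP) ?is_edge_pair.
by have := uniq_leq_size us ss; rewrite size_iota size_map -cardE.
Qed.

(** The default [v] makes this, for a proper colouring, an involution fixing exactly the vertices
    that miss [c]; alternating chains become orbits of two involutions. *)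
Definition step_col f c v := odflt v [pick y | e v y && (f [set v; y] == c)].

Lemma step_col_edge t f c v y : proper_coloring e t f ->
  e v y -> f [set v; y] = c -> step_col f c v = y.
Proof.
move=> fP evy fE; rewrite /step_col; case: pickP => [z /andP[evz /eqP fz]|/(_ y)].
  by apply: (proper_pair_inj fP evz evy); rewrite fE.
by rewrite evy fE eqxx.
Qed.

Lemma step_col_miss f c v : misses f v c -> step_col f c v = v.
Proof.
move=> /forallP vc; rewrite /step_col; case: pickP => // y /andP[evy fy].
by have := vc y; rewrite evy fy.
Qed.

Lemma step_colK t f c : proper_coloring e t f -> involutive (step_col f c).
Proof.
move=> fP v; have [vc|/missesPn[y evy fy]] := boolP (misses f v c).
  by rewrite !step_col_miss ?step_col_miss.
rewrite (step_col_edge fP evy fy).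
by apply: (step_col_edge fP); rewrite 1?sym // setUC.
Qed.

(** * Vizing fans *)

(** Its paths are Vizing fans at [u]: the colour of each later edge is missing at the preceding
    vertex. The colour [d], to be eliminated, stands in for being uncoloured. *)
Definition fan_rel d f u : rel T :=
  fun z z' => [&& e u z', misses f z (f [set u; z']) & f [set u; z'] != d].

Lemma fan_adj d f u x p : e u x -> path (fan_rel d f u) x p -> all (e u) (x :: p).
Proof.
elim: p x => [|y p IHp] x eux /=; first by rewrite eux.
by case/andP=> /and3P[euy _ _] /(IHp _ euy); rewrite eux.
Qed.

(** Induction from the far end: giving [c] to the last edge frees its old colour at [u], and the
    preceding vertex misses that colour already, so the shorter fan can be shifted with it. *)
Lemma shift_fan t d f u x p c : proper_coloring e t f -> e u x ->
  path (fan_rel d f u) x p -> uniq (x :: p) ->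
  misses f u c -> misses f (last x p) c -> 1 <= c <= t -> c != d ->
  exists g, [/\ kempe_equiv e t f g,
    (forall A, is_edge e A -> g A = d -> f A = d) & g [set u; x] != d].
Proof.
move=> fP eux; elim/last_ind: p => [|p y IHp] in f c fP *.
  move=> _ _ uc xc ct cd; exists (recolor f [set u; x] c); split.
  - apply: recolor_kempe => // [|B]; first exact: is_edge_pair.
    move=> /adj_edgesP[_ eB _ [z]]; rewrite !inE => /orP[] /eqP-> zB.
      exact: (missesP _ _ _ uc).
    exact: (missesP _ _ _ xc).
  - by move=> A eA; rewrite /recolor; case: eqP => // _ /eqP; rewrite (negPf cd).
  - by rewrite /recolor eqxx.
move=> pP pU; rewrite last_rcons => uc yc ct cd.
have := fan_adj eux pP; rewrite -rcons_cons all_rcons => /andP[euy adjp].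
move: pP pU; rewrite rcons_path -rcons_cons rcons_uniq.
move=> /andP[pP /and3P[_ lastP fyd]] /andP[yp pU].
set A := [set u; y] in lastP fyd; have eA : is_edge e A by apply: is_edge_pair.
have fgE : kempe_equiv e t f (recolor f A c).
  apply: recolor_kempe => // B /adj_edgesP[_ eB _ [z]].
  by rewrite !inE => /orP[] /eqP-> zB; [apply: (missesP _ _ _ uc)|apply: (missesP _ _ _ yc)].
(* The recoloured edge avoids the remaining fan vertices, so the edges at them keep their
   colours. *)
have offA z : z \in x :: p -> z \notin A.
  move=> zp; rewrite !inE negb_or; apply/andP; split.
    by apply: contraTneq (allP adjp _ zp) => ->; rewrite irr.
  by apply: contraNneq yp => <-.
have recE z B : z \in x :: p -> z \in B -> recolor f A c B = f B.
  by move=> /offA zA zB; rewrite /recolor; case: eqP zB zA => // -> ->.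
have missE z b : z \in x :: p -> misses f z b -> misses (recolor f A c) z b.
  move=> zp /missesP zb; apply/missesP => B eB zB; rewrite (recE z) //; exact: zb.
have [|||||g [gE gd gx]] := IHp (recolor f A c) (f A) (kempe_equiv_proper fgE fP) _ pU.
- apply: (sub_in_path (P := mem (x :: p))) pP; last exact/allP.
  move=> z z' zp z'p; rewrite /fan_rel (recE z' [set u; z']) ?set22 //.
  by case/and3P=> -> /missE-> // ->.
- apply/missesP => B eB uB; rewrite /recolor; have [_|BA] := eqVneq B A.
    by rewrite eq_sym; apply: (missesP _ _ _ uc); rewrite ?set21.
  by apply: contraNneq BA => fBA; apply/eqP; apply: (proper_edge_inj fP eB eA uB _ fBA); apply: set21.
- by apply: missE => //; apply: mem_last.
- exact: (proj1 fP).
- exact: fyd.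
exists g; split=> //; first exact: rt_trans fgE gE.
move=> B eB /(gd _ eB); rewrite /recolor; case: eqP => // _ cd'.
by rewrite cd' eqxx in cd.
Qed.

(** If [u] misses [a], this orbit is closed under both involutions, hence is the vertex set of the
    whole alternating chain from [u]. *)
Definition chain f a b u := fconnect (fun x => step_col f b (step_col f a x)) u.

Lemma chain_edge t f a b u B y z : proper_coloring e t f -> misses f u a ->
  is_edge e B -> f B \in [:: a; b] -> y \in B -> z \in B ->
  chain f a b u y -> chain f a b u z.
Proof.
move=> fP ua eB fB yB; have [y' eyy' BE] := is_edge_at eB yB.
rewrite {1}BE !inE => /orP[] /eqP-> // uy.
move: fB; rewrite BE !inE => /orP[] /eqP fB; rewrite -(step_col_edge fP eyy' fB).
  by apply: orbit_s => //; [apply: step_colK fP|apply: step_colK fP|apply: step_col_miss].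
by apply: orbit_s' => //; [apply: step_colK fP|apply: step_colK fP|apply: step_col_miss].
Qed.

(* Up to its first vertex that misses [b] and is off the chain of [u], the fan
   survives the interchange at that vertex, after which it can be shifted. *)
Lemma swap_shift_fan t d f u x p a b :
  let Q z := misses f z b && ~~ chain f a b u z in
  proper_coloring e t f -> e u x ->
  path (fan_rel d f u) x p -> uniq (x :: p) -> misses f u a ->
  1 <= a <= t -> 1 <= b <= t -> a != d -> b != d ->
  Q (last x p) ->
  exists g, [/\ kempe_equiv e t f g,
    (forall A, is_edge e A -> g A = d -> f A = d) & g [set u; x] != d].
Proof.
move=> Q fP eux pP pU ua at_ bt ad bd.
case/(first_on_path pP pU) => {pP pU}q [pP pU Ql Qb _].
set w := last x q in Ql; have /andP[wb wu] := Ql.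
have [wa|/missesPn[w' eww' fw']] := boolP (misses f w a).
  exact: (shift_fan fP eux pP pU ua).
set A0 := [set w; w'] in fw'; have eA0 : is_edge e A0 by apply: is_edge_pair.
pose C B := connect (ab_rel e f a b) A0 B.
pose g B := if C B then swap_col a b (f B) else f B.
have f0 : f A0 \in [:: a; b] by rewrite fw' mem_head.
have fg : kempe_step e t f g by exists a, b, A0.
have gP := kempe_step_proper fg fP.
(* The chain of [u] absorbs every edge coloured [a] or [b] that touches it, so the component of
   [A0], which contains [w] off the chain, never meets it. *)
have Coff B : C B -> is_edge e B /\ {in B, forall z, ~~ chain f a b u z}.
  move=> /connectP[s]; elim/last_ind: s B => [B _ ->|s B' IHs B].
    split=> // z zA; apply: contra wu.
    by apply: (chain_edge fP ua eA0) => //; apply: set21.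
  rewrite rcons_path last_rcons => /andP[/IHs/(_ erefl)[_ off] /and3P[adj _ fB]] ->.
  have [_ eB _ [y yl yB]] := adj_edgesP adj.
  split=> // z zB; apply: contra (off y yl).
  exact: (chain_edge fP ua eB).
have gE z B : z \in B -> chain f a b u z -> g B = f B.
  by move=> zB uz; rewrite /g; case: ifP => // /Coff[_ /(_ _ zB)]; rewrite uz.
have uu : chain f a b u u by apply: connect0.
have guE z : g [set u; z] = f [set u; z] by apply: (gE u); rewrite ?set21.
have dab : d \notin [:: a; b] by rewrite !inE negb_or ![d == _]eq_sym ad.
have gd B : (g B == d) = (f B == d) by rewrite /g; case: ifP => // _; rewrite swap_col_eq.
have gua : misses g u a.
  by apply/missesP => B eB uB; rewrite (gE u) //; apply: (missesP _ _ _ ua).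
(* The only edge at [w] coloured [a] was [A0], which becomes [b]; and none was coloured [b]. *)
have gwa : misses g w a.
  apply/missesP => B eB wB; rewrite /g; case: ifPn => [CB|].
    apply: contraTneq (missesP _ _ _ wb B eB wB) => fB.
    by rewrite negbK -(swap_colK a b (f B)) fB /swap_col eqxx.
  apply: contraNneq => fB; rewrite /C.
  have -> : B = A0 by apply: (proper_edge_inj fP eB eA0 wB); rewrite ?set21 ?fB.
  exact: connect0.
have gpP : path (fan_rel d g u) x q.
  apply: sub_belast_path Qb pP => z z' Qz; rewrite /fan_rel guE.
  case/and3P=> euz' zc ->; rewrite euz' andbT /=.
  have ca : f [set u; z'] != a.
    by apply: (missesP _ _ _ ua); rewrite ?is_edge_pair ?set21.
  (* A fan edge coloured [b] follows a vertex missing [b]; as that vertex precedes [w], it lies on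
     the chain, where the swap changes nothing. *)
  have [cb|cb] := eqVneq (f [set u; z']) b.
    move: Qz; rewrite /= /Q -cb zc /= negbK cb => uz.
    apply/missesP => B eB zB; rewrite (gE z) //.
    by rewrite -cb; apply: (missesP _ _ _ zc).
  apply/missesP => B eB zB; rewrite /g; case: ifP => _; last exact: (missesP _ _ _ zc).
  rewrite swap_col_eq; first exact: (missesP _ _ _ zc).
  by rewrite !inE negb_or ca.
have [h [gh hd hx]] := shift_fan gP eux gpP pU gua gwa at_ ad.
exists h; split=> //; first by apply: rt_trans gh; apply: rt_step; left.
by move=> B eB /(hd _ eB)/eqP; rewrite gd => /eqP.
Qed.

(** If [u] misses [m z] for some [z] reached by a fan, that fan is shifted. Otherwise following
    colour [m z] from [u] maps the reachable set [R] into itself minus [x], so two vertices of [R]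
    share a missing colour. At most one of them is on the alternating chain of [u]; the other allows
    an interchange. *)
Lemma free_edge_kempe t f u x : maxdeg e < t -> proper_coloring e t.+1 f ->
  e u x -> f [set u; x] = t.+1 ->
  exists g, [/\ kempe_equiv e t.+1 f g,
    (forall A, is_edge e A -> g A = t.+1 -> f A = t.+1) & g [set u; x] != t.+1].
Proof.
move=> dt fP eux fux.
have miss v : exists c, (1 <= c <= t) && misses f v c.
  have [|c ct cv] := @ex_misses f v t; last by exists c; rewrite ct.
  by apply: leq_ltn_trans dt; apply: (leq_bigmax v).
pose m v := xchoose (miss v).
have mt v : 1 <= m v <= t by have /andP[] := xchooseP (miss v).
have mm v : misses f v (m v) by have /andP[] := xchooseP (miss v).
have mT v : 1 <= m v <= t.+1 by have /andP[-> /leqW] := mt v.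
have md v : m v != t.+1.
  by apply: contraTneq (mt v) => ->; rewrite ltnn andbF.
pose R := [pred z | connect (fan_rel t.+1 f u) x z].
pose fan z p := [/\ path (fan_rel t.+1 f u) x p, uniq (x :: p) & last x p = z].
have RP z : z \in R -> exists p, fan z p.
  by case/connectP=> p /shortenP[q qP qU _] ->; exists q.
have [/existsP[z /andP[/RP[p [pP pU pl]] zu]]|] := boolP [exists z, (z \in R) && misses f u (m z)].
  by apply: (shift_fan fP eux pP pU zu); rewrite ?pl.
rewrite negb_exists => /forallP noR.
have nx z : z \in R -> [/\ e u (step_col f (m z) u),
    f [set u; step_col f (m z) u] = m z & step_col f (m z) u \in [predD1 R & x]].
  move=> zR; have := noR z; rewrite zR => /missesPn[y euy fy].
  rewrite (step_col_edge fP euy fy); split=> //.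
  rewrite inE /=; apply/andP; split.
    (* The edge to [x] has colour [t.+1], whereas [m z <= t]. *)
    by apply: contraNneq (md z) => yx; rewrite -fy yx fux.
  apply: connect_trans zR (connect1 _); rewrite /fan_rel euy fy md mm //.
have /dinjectivePn[y yR [z]] : ~~ dinjectiveb (fun z => step_col f (m z) u) R.
  apply/negP => /dinjectiveP/card_in_imset cR.
  have xR : x \in R by apply: connect0.
  have : [set step_col f (m z) u | z in R] \subset [predD1 R & x].
    by apply/subsetP => _ /imsetP[z /nx[_ _ ?] ->].
  by move/subset_leq_card; rewrite cR [X in X <= _](cardD1 x) xR ltnn.
rewrite inE /= => /andP[zy zR] yz.
have mE : m z = m y by have [_ <- _] := nx z zR; have [_ <- _] := nx y yR; rewrite yz.
have [a /andP[at_ ua]] := miss u.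
have aT : 1 <= a <= t.+1 by have /andP[-> /leqW] := at_.
have ad : a != t.+1 by apply: contraTneq at_ => ->; rewrite ltnn andbF.
have main w : w \in R -> m w = m y -> ~~ chain f a (m y) u w -> exists g,
    [/\ kempe_equiv e t.+1 f g,
    (forall A, is_edge e A -> g A = t.+1 -> f A = t.+1) & g [set u; x] != t.+1].
  move=> /RP[p [pP pU pl]] mw wu.
  by apply: (swap_shift_fan fP eux pP pU ua aT (mT y) ad (md y)); rewrite pl -mw mm mw.
have [uy|] := boolP (chain f a (m y) u y); last exact: main.
have [uz|] := boolP (chain f a (m y) u z); last exact: main.
(* Otherwise [y] and [z] are two fixed points of the second involution in the orbit of [u], which
   the first one fixes. *)
case/negP: zy; apply/eqP; apply: (orbit_fixed_unique _ _ _ uz uy).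
- exact: step_colK fP.
- exact: step_colK fP.
- exact: step_col_miss.
- by apply: step_col_miss; rewrite -mE.
- exact: step_col_miss.
Qed.

(** Induction on the number of edges coloured [t.+1]: each round frees one and creates none. *)
Lemma vizing_kempe t f : maxdeg e < t -> proper_coloring e t.+1 f ->
  exists2 g, kempe_equiv e t.+1 f g & proper_coloring e t g.
Proof.
move=> dt; pose K h := [set A | is_edge e A && (h A == t.+1)].
have [n] := ubnP #|K f|; elim: n f => // n IHn f; rewrite ltnS => fn fP.
have [K0|[A]] := set_0Vmem (K f).
  exists f; first exact: rt_refl.
  split; last exact: (proj2 fP).
  move=> A eA; have /andP[-> ] := proj1 fP A eA; rewrite leq_eqVlt ltnS.
  by have /setP/(_ A) := K0; rewrite !inE eA /= => ->.
rewrite inE => /andP[/is_edgeP[u [x [eux ->]]] /eqP fux].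
have [g [fg gd gux]] := free_edge_kempe dt fP eux fux.
have [||h gh hP] := IHn g.
- apply: leq_trans fn; apply: proper_card; apply/properP; split.
    by apply/subsetP => B; rewrite !inE => /andP[eB /eqP/(gd _ eB)->]; rewrite eB /=.
  by exists [set u; x]; rewrite !inE is_edge_pair //= fux.
- exact: kempe_equiv_proper fg fP.
by exists h => //; apply: rt_trans fg gh.
Qed.

End Coloring.

(** * Deleting a set of edges *)

Section Deletion.
Variables (T : finType) (e : rel T) (M : pred {set T}).
Hypotheses (sym : symmetric e) (irr : irreflexive e).

Definition del_edges : rel T := fun x y => e x y && ~~ M [set x; y].

Lemma del_edges_sym : symmetric del_edges.
Proof. by move=> x y; rewrite /del_edges sym setUC. Qed.

Lemma del_edges_irr : irreflexive del_edges.
Proof. by move=> x; rewrite /del_edges irr. Qed.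

Lemma is_edge_del A : is_edge del_edges A = is_edge e A && ~~ M A.
Proof.
apply/is_edgeP/andP => [[x [y [/andP[exy MN] ->]]]|[]].
  by rewrite is_edge_pair.
by case/is_edgeP=> x [y [exy ->]] MN; exists x, y; rewrite /del_edges exy.
Qed.

Lemma adj_edges_del A B :
  adj_edges del_edges A B = [&& adj_edges e A B, ~~ M A & ~~ M B].
Proof.
rewrite /adj_edges !is_edge_del.
by case: (is_edge e A); case: (is_edge e B); case: (M A); case: (M B); rewrite ?andbF ?andbT.
Qed.

Lemma maxdeg_del : maxdeg del_edges <= maxdeg e.
Proof.
apply/bigmax_leqP => v _; apply: leq_trans (leq_bigmax v).
by apply/subset_leq_card/subsetP => y; rewrite !inE => /andP[].
Qed.

Definition extend c (f : coloring T) : coloring T := fun A => if M A then c else f A.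

(** Interchanges in the subgraph use colours at most [t], so the edges of [M], coloured [t.+1],
    never enter a component. *)
Lemma extend_kempe t f g : kempe_equiv del_edges t f g ->
  kempe_equiv e t.+1 (extend t.+1 f) (extend t.+1 g).
Proof.
elim=> [{}f {}g fg|{}f|{}f {}g h _ gf _ hg]; last exact: rt_trans gf hg; last first.
  exact: rt_refl.
apply: rt_step; case: fg => [[a [b [A0 [/andP[a1 at_] /andP[b1 bt] eA0 fA0 gE]]]]|fg]; last first.
  right=> A eA; rewrite /extend; case: ifP => // MA; apply: fg.
  by rewrite is_edge_del eA MA.
left; exists a, b, A0.
have tab : t.+1 \notin [:: a; b] by rewrite !inE !gtn_eqF.
have relE : ab_rel e (extend t.+1 f) a b =2 ab_rel del_edges f a b.
  move=> A B; rewrite /ab_rel adj_edges_del /extend.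
  by case: (M A); case: (M B); rewrite ?(negPf tab) ?andbF ?andbT.
move: eA0; rewrite is_edge_del => /andP[eA0 /negPf MA0].
split; rewrite ?a1 ?b1 ?leqW //; first by rewrite /extend MA0.
move=> A eA; rewrite (eq_connect relE) /extend; case: ifP => MA.
  by rewrite swap_col_id // if_same.
by apply: gE; rewrite is_edge_del eA MA.
Qed.

Lemma extend_proper t f :
  (forall A B, adj_edges e A B -> M A -> ~~ M B) ->
  proper_coloring del_edges t f -> proper_coloring e t.+1 (extend t.+1 f).
Proof.
move=> mM [f1 f2].
have fE A : is_edge e A -> ~~ M A -> 1 <= f A <= t.
  by move=> eA MA; apply: f1; rewrite is_edge_del eA.
have fN A : is_edge e A -> ~~ M A -> t.+1 != f A.
  by move=> eA MA; have /andP[_ ft] := fE _ eA MA; rewrite gtn_eqF.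
split=> [A eA|A B AB]; rewrite /extend.
  by have [_|/(fE _ eA)/andP[-> /leqW]] := boolP (M A); rewrite ?leqnn.
have [eA eB _ _] := adj_edgesP AB.
have [MA|MA] := boolP (M A); have [MB|MB] := boolP (M B).
- by have := mM _ _ AB MA; rewrite MB.
- exact: fN.
- by rewrite eq_sym fN.
- by apply: f2; rewrite adj_edges_del AB MA.
Qed.

Lemma proper_del t f : proper_coloring e t f -> proper_coloring del_edges t f.
Proof.
move=> [f1 f2]; split=> [A|A B]; first by rewrite is_edge_del => /andP[/f1].
by rewrite adj_edges_del => /andP[/f2].
Qed.

Lemma proper_del_class t f : proper_coloring e t.+1 f ->
  (forall A, is_edge e A -> f A = t.+1 -> M A) -> proper_coloring del_edges t f.
Proof.
move=> fP fM; have [f1 f2] := proper_del fP; split=> // A eA.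
have /andP[-> ft] := f1 A eA; rewrite -ltnS ltn_neqAle ft andbT.
move: eA; rewrite is_edge_del => /andP[eA].
by apply: contraNneq; apply: fM.
Qed.

Lemma extend_matching_kempe t f : proper_coloring e t f ->
  (forall A B, adj_edges e A B -> M A -> ~~ M B) ->
  kempe_equiv e t.+1 f (extend t.+1 f).
Proof.
move=> fP mM; pose s := enum [pred A | is_edge e A && M A].
have sE A : (A \in s) = is_edge e A && M A by rewrite mem_enum.
apply: rt_trans (_ : kempe_equiv _ _ _ (fun A => if A \in s then t.+1 else f A)) _.
  apply: recolor_matching_kempe; rewrite ?leqnn //.
  - exact: proper_widen fP.
  - by move=> A; rewrite sE => /andP[].
  - move=> A B; rewrite !sE => /andP[_ MA] /andP[_ MB].
    by apply: contraL MB => AB; apply: mM MA.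
  - by move=> A /(proj1 fP)/andP[_]; rewrite neq_ltn ltnS => ->.
by apply: agree_kempe_equiv => A eA; rewrite /extend sE eA.
Qed.

(** Restoring the class as colour [j.+1] turns a [j]-colouring of the rest into a [j.+1]-colouring,
    so the index drops by exactly one. *)
Lemma chromatic_index_del_class t f : chromatic_index e t.+1 ->
  proper_coloring e t.+1 f -> (forall A, M A = (f A == t.+1)) ->
  chromatic_index del_edges t.
Proof.
move=> [_ min] fP ME; split=> [|j [h hP]].
  by exists f; apply: proper_del_class fP _ => A _ fA; rewrite ME fA.
rewrite -ltnS; apply: min; exists (extend j.+1 h); apply: extend_proper hP.
by move=> A B AB; rewrite !ME => /eqP <-; rewrite eq_sym (proj2 fP).
Qed.

End Deletion.

(** * The two implications *)

(** The step treats index [c.+1]: the matching is class [c.+1] of [g'], its new colour is [c.+2],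
    and the graph left has index [c]. *)
Lemma vizing_kempe_equiv k :
  (forall (T : finType) (e : rel T), symmetric e -> irreflexive e ->
     maxdeg e <= k -> class1 e -> vizing_property e) ->
  forall c (T : finType) (e : rel T), symmetric e -> irreflexive e ->
    maxdeg e <= k -> chromatic_index e c ->
    forall f g, proper_coloring e c.+1 f -> proper_coloring e c.+1 g ->
      kempe_equiv e c.+1 f g.
Proof.
move=> viz; elim=> [|c IHc] T e sym irr ek ec f g fP gP.
  (* Index 0 excludes edges: a colour would lie between 1 and 0. *)
  apply: agree_kempe_equiv => A eA; have [[h [/(_ A eA)]]] := ec.
  by case: (h A).
have reduce h : proper_coloring e c.+2 h ->
    exists2 h', kempe_equiv e c.+2 h h' & proper_coloring e c.+1 h'.
  move=> hP; have [[h0 /(proper_maxdeg irr)]] := ec.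
  rewrite leq_eqVlt => /orP[/eqP dc _|dc _]; last exact: vizing_kempe dc hP.
  have e1 : class1 e by rewrite /class1 dc.
  have [|h' []] := viz T e sym irr ek e1 c.+2 _ h hP; rewrite dc //.
  by exists h'.
have [f' ff' f'P] := reduce f fP; apply: rt_trans ff' _.
have [g' gg' g'P] := reduce g gP.
apply: rt_trans _ (kempe_equiv_sym gg').
pose M A := g' A == c.+1.
have mM A B : adj_edges e A B -> M A -> ~~ M B.
  by move=> AB /eqP gA; rewrite /M -gA eq_sym (proj2 g'P).
apply: rt_trans (extend_matching_kempe f'P mM) _.
apply: rt_trans _ (kempe_equiv_sym (extend_matching_kempe g'P mM)).
(* Off [M], both [f'] and [g'] count as [c.+1]-colourings, one colour more than the index there. *)
apply/extend_kempe/IHc; [exact: del_edges_sym|exact: del_edges_irr| | | | ].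
- exact: leq_trans (maxdeg_del e M) ek.
- exact: chromatic_index_del_class g'P _.
- exact: proper_del.
- exact: proper_del.
Qed.

Lemma kempe_equiv_vizing (T : finType) (e : rel T) :
  symmetric e -> irreflexive e -> class1 e ->
  (forall f g, proper_coloring e (maxdeg e).+1 f ->
     proper_coloring e (maxdeg e).+1 g -> kempe_equiv e (maxdeg e).+1 f g) ->
  vizing_property e.
Proof.
move=> sym irr [[h hP] _] eqv; elim=> // t IHt; rewrite ltnS leq_eqVlt.
case/orP=> [/eqP <- f fP|dt f fP].
  (* With one colour above the maximum degree, the hypothesis relates [f] directly to the optimal
     colouring [h] given by Class 1. *)
  by exists h; split=> //; apply: eqv => //; apply: proper_widen hP.
have [g fg /(IHt dt)[g' [gg' g'P]]] := vizing_kempe sym irr dt fP.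
exists g'; split=> //; apply: rt_trans fg _.
exact: kempe_equiv_widen gg'.
Qed.

Theorem theorem1p1 (k : nat) : 2 <= k ->
  ((forall (T : finType) (e : rel T), symmetric e -> irreflexive e ->
      maxdeg e <= k -> class1 e -> vizing_property e)
   <->
   (forall (T : finType) (e : rel T), symmetric e -> irreflexive e ->
      maxdeg e <= k -> forall c, chromatic_index e c ->
      forall f g, proper_coloring e c.+1 f -> proper_coloring e c.+1 g ->
        kempe_equiv e c.+1 f g)).
Proof.
move=> _; split=> [viz T e sym irr ek c|eqv T e sym irr ek e1].
  exact: vizing_kempe_equiv viz c T e sym irr ek.
exact: kempe_equiv_vizing sym irr e1 (eqv T e sym irr ek _ e1).
Qed.
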